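(* Let $\mathcal{Q}$ be a small quantaloid. The functor $\mathcal{F}:\mathcal{Q}\text{-}\mathbf{Cls}\to\mathcal{Q}\text{-}\mathbf{Info}$, given by $\mathcal{F}(\mathbb{A},C)=(\zeta_C:\mathbb{A}\rightsquigarrow C(\mathcal{P}\mathbb{A}))$, is a left adjoint and right inverse of the functor $\mathcal{U}:\mathcal{Q}\text{-}\mathbf{Info}\to\mathcal{Q}\text{-}\mathbf{Cls}$, given by $\mathcal{U}(\phi:\mathbb{A}\rightsquigarrow\mathbb{B})=(\mathbb{A},\phi^{\downarrow}\circ\phi_{\uparrow})$.
   Context: A quantaloid $\mathcal{Q}$ is a category whose hom-sets are complete lattices and whose composition preserves arbitrary joins in each variable; it is small if its objects $\mathcal{Q}_0$ and arrows form sets. For $f:X\to Y$, $g:Y\to Z$, $h:X\to Z$ in a quantaloid, $h\swarrow f:Y\to Z$ is the largest arrow with $(h\swarrow f)\circ f\le h$, and $g\searrow h:X\to Y$ is the largest arrow with $g\circ(g\searrow h)\le h$. A $\mathcal{Q}$-category $\mathbb{A}$ is a set $\mathbb{A}_0$ with a type map $t:\mathbb{A}_0\to\mathcal{Q}_0$ and hom-arrows $\mathbb{A}(x,y)\in\mathcal{Q}(tx,ty)$ with $1_{tx}\le\mathbb{A}(x,x)$ and $\mathbb{A}(y,z)\circ\mathbb{A}(x,y)\le\mathbb{A}(x,z)$. A $\mathcal{Q}$-functor $F:\mathbb{A}\to\mathbb{B}$ is a type-preserving map with $\mathbb{A}(x,x')\le\mathbb{B}(Fx,Fx')$. The underlying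 preorder on $\mathbb{A}_0$ is: $x\le y$ iff $tx=ty$ and $1_{tx}\le\mathbb{A}(x,y)$; $\mathcal{Q}$-functors are ordered pointwise. A $\mathcal{Q}$-distributor $\phi:\mathbb{A}\rightsquigarrow\mathbb{B}$ assigns to each $(x,y)\in\mathbb{A}_0\times\mathbb{B}_0$ an arrow $\phi(x,y)\in\mathcal{Q}(tx,ty)$ with $\mathbb{B}(y',y)\circ\phi(x,y')\le\phi(x,y)$ and $\phi(x',y)\circ\mathbb{A}(x,x')\le\phi(x,y)$. $\mathcal{Q}$-categories and $\mathcal{Q}$-distributors form a quantaloid with pointwise order, composition $(\psi\circ\phi)(x,z)=\bigvee_y\psi(y,z)\circ\phi(x,y)$, identities given by hom-arrows, and implications $(\eta\swarrow\phi)(y,z)=\bigwedge_x\eta(x,z)\swarrow\phi(x,y)$, $(\psi\searrow\eta)(x,y)=\bigwedge_z\psi(y,z)\searrow\eta(x,z)$. For $X\in\mathcal{Q}_0$, $*_X$ is the $\mathcal{Q}$-category with one object of type $X$ and hom-arrow $1_X$. $\mathcal{P}\mathbb{A}$ has as objects of type $X$ the distributors $\mu:\mathbb{A}\rightsquigarrow *_X$ (write $\mu(x)$ for $\mu(x,* )$), with $\mathcal{P}\mathbb{A}(\mu,\lambda)=\lambda\swarrow\mu$. $\mathcal{P}^{\dagger}\mathbb{A}$ has as objects of type $X$ the distributors $\mu:*_X\rightsquigarrow\mathbb{A}$, with $\mathcal{P}^{\dagger}\mathbb{A}(\mu,\lambda)=\lambda\searrow\mu$. For $\phi:\mathbb{A}\rightsquigarrow\mathbb{B}$: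 $\phi_{\uparrow}:\mathcal{P}\mathbb{A}\to\mathcal{P}^{\dagger}\mathbb{B}$, $\phi_{\uparrow}(\mu)=\phi\swarrow\mu$, and $\phi^{\downarrow}:\mathcal{P}^{\dagger}\mathbb{B}\to\mathcal{P}\mathbb{A}$, $\phi^{\downarrow}(\lambda)=\lambda\searrow\phi$. For a $\mathcal{Q}$-functor $F:\mathbb{A}\to\mathbb{B}$, let $F_{\natural}(x,y)=\mathbb{B}(Fx,y)$, $F^{\natural}(y,x)=\mathbb{B}(y,Fx)$, and $F^{\rightarrow}:\mathcal{P}\mathbb{A}\to\mathcal{P}\mathbb{B}$, $F^{\rightarrow}(\mu)=\mu\circ F^{\natural}$, $F^{\leftarrow}:\mathcal{P}\mathbb{B}\to\mathcal{P}\mathbb{A}$, $F^{\leftarrow}(\lambda)=\lambda\circ F_{\natural}$. $\mathcal{Q}\text{-}\mathbf{Info}$: objects are $\mathcal{Q}$-distributors; a morphism (infomorphism) $(F,G)$ from $\phi:\mathbb{A}\rightsquigarrow\mathbb{B}$ to $\psi:\mathbb{A}'\rightsquigarrow\mathbb{B}'$ is a pair of $\mathcal{Q}$-functors $F:\mathbb{A}\to\mathbb{A}'$, $G:\mathbb{B}'\to\mathbb{B}$ with $\phi(x,Gy')=\psi(Fx,y')$ for all $x,y'$. $\mathcal{Q}\text{-}\mathbf{Cls}$: objects are $\mathcal{Q}$-closure spaces $(\mathbb{A},C)$, i.e. a $\mathcal{Q}$-category $\mathbb{A}$ and a $\mathcal{Q}$-functor $C:\mathcal{P}\mathbb{A}\to\mathcal{P}\mathbb{A}$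 with $1\le C$, $C\circ C=C$; morphisms $(\mathbb{A},C)\to(\mathbb{B},D)$ are $\mathcal{Q}$-functors $F:\mathbb{A}\to\mathbb{B}$ with $F^{\rightarrow}\circ C\le D\circ F^{\rightarrow}$ (continuous $\mathcal{Q}$-functors). $C(\mathcal{P}\mathbb{A})$ is the full $\mathcal{Q}$-subcategory of $\mathcal{P}\mathbb{A}$ of fixed points of $C$. If $F$ is continuous, $F^{\leftarrow}$ restricts to $F^{\triangleleft}:D(\mathcal{P}\mathbb{B})\to C(\mathcal{P}\mathbb{A})$. The functor $\mathcal{U}$ sends an infomorphism $(F,G):\phi\to\psi$ to the continuous $\mathcal{Q}$-functor $F:(\mathbb{A},\phi^{\downarrow}\circ\phi_{\uparrow})\to(\mathbb{A}',\psi^{\downarrow}\circ\psi_{\uparrow})$. The functor $\mathcal{F}$ sends $(\mathbb{A},C)$ to the distributor $\zeta_C:\mathbb{A}\rightsquigarrow C(\mathcal{P}\mathbb{A})$, $\zeta_C(x,\mu)=\mu(x)$, and a continuous $\mathcal{Q}$-functor $F:(\mathbb{A},C)\to(\mathbb{B},D)$ to $(F,F^{\triangleleft}):\zeta_C\to\zeta_D$. ''Right inverse'' means that $\mathcal{U}\circ\mathcal{F}$ is the identity functor on $\mathcal{Q}\text{-}\mathbf{Cls}$. *)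

(* Defs.v *)
From Corelib Require Import ssreflect ssrfun ssrbool.
From Stdlib Require Import FunctionalExtensionality ProofIrrelevance.

Set Implicit Arguments.
Unset Strict Implicit.
Unset Printing Implicit Defensive.

#[local] Obligation Tactic := idtac.

Record category := Category {
  obj :> Type;
  mor : obj -> obj -> Type;
  idm : forall a, mor a a;
  compm : forall a b c, mor b c -> mor a b -> mor a c;
  compmA : forall a b c d (h : mor c d) (g : mor b c) (f : mor a b),
    compm h (compm g f) = compm (compm h g) f;
  comp1m : forall a b (f : mor a b), compm (idm b) f = f;
  compm1 : forall a b (f : mor a b), compm f (idm a) = f }.

Arguments mor {_} _ _.
Arguments idm {_} _.
Arguments compm {_ _ _ _} _ _.

Record functor (C D : category) := Functor {
  fobj :> C -> D;
  fmor : forall a b, mor a b -> mor (fobj a) (fobj b);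
  fmor1 : forall a, fmor (idm a) = idm (fobj a);
  fmorM : forall a b c (g : mor b c) (f : mor a b),
    fmor (compm g f) = compm (fmor g) (fmor f) }.

Arguments fmor {_ _} _ {_ _} _.

Definition functor_id (C : category) : functor C C :=
  @Functor C C (fun a => a) (fun _ _ f => f)
    (fun _ => eq_refl) (fun _ _ _ _ _ => eq_refl).

Program Definition functor_comp (C D E : category)
    (G : functor D E) (F : functor C D) : functor C E :=
  @Functor C E (fun a => G (F a)) (fun _ _ f => fmor G (fmor F f)) _ _.
Next Obligation. move=> C D E G F a /=; by rewrite !fmor1. Qed.
Next Obligation. move=> C D E G F a b c g f /=; by rewrite !fmorM. Qed.

Definition left_adjoint (C D : category) (F : functor C D) (G : functor D C) :
    Prop :=
  exists Phi : forall (c : C) (d : D), mor (F c) d -> mor c (G d),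
    (forall c d, bijective (Phi c d)) /\
    (forall (c c' : C) (d d' : D)
       (u : mor c' c) (v : mor d d') (f : mor (F c) d),
       Phi c' d' (compm v (compm f (fmor F u)))
       = compm (fmor G v) (compm (Phi c d f) u)).

(** Completeness is given by suprema of arbitrary predicates.  The objects and
    the arrows live in [Type]; smallness of the quantaloid is that they live in
    the universe of the object sets of the categories enriched in it. *)
Record quantaloid := Quantaloid {
  qob :> Type;
  qarr : qob -> qob -> Type;
  qle : forall X Y, qarr X Y -> qarr X Y -> Prop;
  qsup : forall X Y, (qarr X Y -> Prop) -> qarr X Y;
  qid : forall X, qarr X X;
  qcomp : forall X Y Z, qarr Y Z -> qarr X Y -> qarr X Z;
  qle_refl : forall X Y (f : qarr X Y), qle f f;
  qle_trans : forall X Y (g f h : qarr X Y), qle f g -> qle g h -> qle f h;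
  qle_anti : forall X Y (f g : qarr X Y), qle f g -> qle g f -> f = g;
  qsup_ub : forall X Y (S : qarr X Y -> Prop) f, S f -> qle f (qsup S);
  qsup_least : forall X Y (S : qarr X Y -> Prop) g,
    (forall f, S f -> qle f g) -> qle (qsup S) g;
  qcompA : forall X Y Z W (h : qarr Z W) (g : qarr Y Z) (f : qarr X Y),
    qcomp h (qcomp g f) = qcomp (qcomp h g) f;
  qcomp1f : forall X Y (f : qarr X Y), qcomp (qid Y) f = f;
  qcompf1 : forall X Y (f : qarr X Y), qcomp f (qid X) = f;
  qcomp_supr : forall X Y Z (g : qarr Y Z) (S : qarr X Y -> Prop),
    qcomp g (qsup S) = qsup (fun h => exists2 f, S f & h = qcomp g f);
  qcomp_supl : forall X Y Z (S : qarr Y Z -> Prop) (f : qarr X Y),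
    qcomp (qsup S) f = qsup (fun h => exists2 g, S g & h = qcomp g f) }.

Arguments qarr {_} _ _.
Arguments qid {_} _.

Declare Scope quant_scope.
Delimit Scope quant_scope with quant.
Local Open Scope quant_scope.

Notation "f ⊑ g" := (qle f g) (at level 70, no associativity) : quant_scope.
Notation "g ∘ f" := (qcomp g f) (at level 40, left associativity) : quant_scope.

Section Quantaloid.
Variable Q : quantaloid.
Implicit Types X Y Z W : Q.

Definition qinf X Y (S : qarr X Y -> Prop) : qarr X Y :=
  qsup (fun g => forall f, S f -> g ⊑ f).

(** [limp h f] is h ↙ f and [rimp g h] is g ↘ h. *)
Definition limp X Y Z (h : qarr X Z) (f : qarr X Y) : qarr Y Z :=
  qsup (fun k => k ∘ f ⊑ h).
Definition rimp X Y Z (g : qarr Y Z) (h : qarr X Z) : qarr X Y :=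
  qsup (fun k => g ∘ k ⊑ h).

Lemma qinfP X Y (S : qarr X Y -> Prop) g :
  g ⊑ qinf S <-> (forall f, S f -> g ⊑ f).
Proof.
split=> [H f Sf|H]; last by apply: qsup_ub.
by apply: (qle_trans H); apply: qsup_least => k; apply.
Qed.

Lemma qcomp_monor X Y Z (g : qarr Y Z) (f f' : qarr X Y) :
  f ⊑ f' -> g ∘ f ⊑ g ∘ f'.
Proof.
move=> H.
have -> : f' = qsup (fun k => k = f \/ k = f').
  apply: qle_anti; first by apply: qsup_ub; right.
  by apply: qsup_least => k [->|->] //; apply: qle_refl.
rewrite qcomp_supr; apply: qsup_ub.
by exists f => //; left.
Qed.

Lemma qcomp_monol X Y Z (g g' : qarr Y Z) (f : qarr X Y) :
  g ⊑ g' -> g ∘ f ⊑ g' ∘ f.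
Proof.
move=> H.
have -> : g' = qsup (fun k => k = g \/ k = g').
  apply: qle_anti; first by apply: qsup_ub; right.
  by apply: qsup_least => k [->|->] //; apply: qle_refl.
rewrite qcomp_supl; apply: qsup_ub.
by exists g => //; left.
Qed.

Lemma limpP X Y Z (h : qarr X Z) (f : qarr X Y) k :
  k ⊑ limp h f <-> k ∘ f ⊑ h.
Proof.
split=> [H|H]; last by apply: qsup_ub.
apply: (qle_trans (qcomp_monol _ H)); rewrite qcomp_supl.
by apply: qsup_least => _ [l Hl ->].
Qed.

Lemma rimpP X Y Z (g : qarr Y Z) (h : qarr X Z) k :
  k ⊑ rimp g h <-> g ∘ k ⊑ h.
Proof.
split=> [H|H]; last by apply: qsup_ub.
apply: (qle_trans (qcomp_monor _ H)); rewrite qcomp_supr.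
by apply: qsup_least => _ [l Hl ->].
Qed.

(** A set equipped with a type map into the objects of Q is encoded as the
    family of the fibres of that map: [A X] is the set of the objects of A of
    type X, the full set of objects is [{X : Q & A X}], and the type map is the
    first projection.  Type-preserving maps are then families of maps between
    fibres. *)
Record qcat := QCat {
  qcob :> Q -> Type;
  qhom : forall X Y, qcob X -> qcob Y -> qarr X Y;
  qhom1 : forall X (x : qcob X), qid X ⊑ qhom x x;
  qhomM : forall X Y Z (x : qcob X) (y : qcob Y) (z : qcob Z),
    qhom y z ∘ qhom x y ⊑ qhom x z }.

(** The underlying preorder; only objects of equal type are comparable, so it
    is a relation on each fibre. *)
Definition ule (A : qcat) X (x y : A X) : Prop := qid X ⊑ qhom x y.

Record qfun (A B : qcat) := QFun {
  qfun_map :> forall X, A X -> B X;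
  qfun_hom : forall X Y (x : A X) (x' : A Y),
    qhom x x' ⊑ qhom (qfun_map x) (qfun_map x') }.

Definition qfun_le (A B : qcat) (F G : qfun A B) : Prop :=
  forall X (x : A X), ule (F X x) (G X x).

Definition qfun_id (A : qcat) : qfun A A :=
  @QFun A A (fun _ x => x) (fun _ _ _ _ => qle_refl _).

Program Definition qfun_comp (A B C : qcat) (G : qfun B C) (F : qfun A B) :
  qfun A C := @QFun A C (fun X x => G X (F X x)) _.
Next Obligation.
move=> A B C G F X Y x x'; apply: qle_trans (qfun_hom _ _ _).
exact: qfun_hom.
Qed.

Record dist (A B : qcat) := Dist {
  dval :> forall X Y, A X -> B Y -> qarr X Y;
  dist_l : forall X Y Y' (x : A X) (y' : B Y') (y : B Y),
    qhom y' y ∘ dval x y' ⊑ dval x y;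
  dist_r : forall X X' Y (x : A X) (x' : A X') (y : B Y),
    dval x' y ∘ qhom x x' ⊑ dval x y }.

Arguments dval {_ _} _ {_ _} _ _.

Program Definition dcomp (A B C : qcat) (psi : dist B C) (phi : dist A B) :
    dist A C :=
  @Dist A C (fun X Z x z =>
    qsup (fun h => exists Y (y : B Y), h = dval psi y z ∘ dval phi x y)) _ _.
Next Obligation.
move=> A B C psi phi X Y Y' x y' y.
rewrite qcomp_supr; apply: qsup_least => _ [_ [W [w ->]] ->].
rewrite qcompA; apply: (@qle_trans _ _ _ (dval psi w y ∘ dval phi x w)).
  by apply: qcomp_monol; apply: dist_l.
by apply: qsup_ub; exists W, w.
Qed.
Next Obligation.
move=> A B C psi phi X X' Y x x' y.
rewrite qcomp_supl; apply: qsup_least => _ [_ [W [w ->]] ->].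
rewrite -qcompA; apply: (@qle_trans _ _ _ (dval psi w y ∘ dval phi x w)).
  by apply: qcomp_monor; apply: dist_r.
by apply: qsup_ub; exists W, w.
Qed.

(** The implications eta ↙ phi and psi ↘ eta of distributors. *)
Program Definition dlimp (A B C : qcat) (eta : dist A C) (phi : dist A B) :
    dist B C :=
  @Dist B C (fun Y Z y z =>
    qinf (fun h => exists X (x : A X), h = limp (dval eta x z) (dval phi x y)))
    _ _.
Next Obligation.
move=> A B C eta phi X Y Y' x y' y.
apply/qinfP => _ [W [w ->]]; apply/limpP; rewrite -qcompA.
apply: (@qle_trans _ _ _ (qhom y' y ∘ dval eta w y')); last exact: dist_l.
apply: qcomp_monor; apply/limpP.
by move/qinfP: (qle_refl (qinf (fun h => exists X0 (x0 : A X0),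
  h = limp (dval eta x0 y') (dval phi x0 x)))); apply; exists W, w.
Qed.
Next Obligation.
move=> A B C eta phi X X' Y x x' y.
apply/qinfP => _ [W [w ->]]; apply/limpP; rewrite -qcompA.
set k := qinf _.
apply: (@qle_trans _ _ _ (k ∘ dval phi w x')).
  by apply: qcomp_monor; apply: dist_l.
apply/limpP; move/qinfP: (qle_refl k); apply; by exists W, w.
Qed.

Program Definition drimp (A B C : qcat) (psi : dist B C) (eta : dist A C) :
    dist A B :=
  @Dist A B (fun X Y x y =>
    qinf (fun h => exists Z (z : C Z), h = rimp (dval psi y z) (dval eta x z)))
    _ _.
Next Obligation.
move=> A B C psi eta X Y Y' x y' y.
apply/qinfP => _ [W [w ->]]; apply/rimpP; rewrite qcompA.
set k := qinf _.
apply: (@qle_trans _ _ _ (dval psi y' w ∘ k)).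
  by apply: qcomp_monol; apply: dist_r.
apply/rimpP; move/qinfP: (qle_refl k); apply; by exists W, w.
Qed.
Next Obligation.
move=> A B C psi eta X X' Y x x' y.
apply/qinfP => _ [W [w ->]]; apply/rimpP; rewrite qcompA.
set k := qinf _.
apply: (@qle_trans _ _ _ (dval eta x' w ∘ qhom x x')); last exact: dist_r.
apply: qcomp_monol; apply/rimpP.
move/qinfP: (qle_refl k); apply; by exists W, w.
Qed.

Lemma dlimpP (A B C : qcat) (eta : dist A C) (phi : dist A B) Y Z
    (y : B Y) (z : C Z) (k : qarr Y Z) :
  k ⊑ dval (dlimp eta phi) y z <->
  forall X (x : A X), k ∘ dval phi x y ⊑ dval eta x z.
Proof.
split=> [/qinfP H X x|H]; first by apply/limpP; apply: H; exists X, x.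
by apply/qinfP => _ [X [x ->]]; apply/limpP.
Qed.

Lemma drimpP (A B C : qcat) (psi : dist B C) (eta : dist A C) X Y
    (x : A X) (y : B Y) (k : qarr X Y) :
  k ⊑ dval (drimp psi eta) x y <->
  forall Z (z : C Z), dval psi y z ∘ k ⊑ dval eta x z.
Proof.
split=> [/qinfP H Z z|H]; first by apply/rimpP; apply: H; exists Z, z.
by apply/qinfP => _ [Z [z ->]]; apply/rimpP.
Qed.

Lemma dlimp_comp (A B C : qcat) (eta : dist A C) (phi : dist A B) X Y Z
    (x : A X) (y : B Y) (z : C Z) :
  dval (dlimp eta phi) y z ∘ dval phi x y ⊑ dval eta x z.
Proof. by move: X x; apply/dlimpP; apply: qle_refl. Qed.

Lemma drimp_comp (A B C : qcat) (psi : dist B C) (eta : dist A C) X Y Z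
    (x : A X) (y : B Y) (z : C Z) :
  dval psi y z ∘ dval (drimp psi eta) x y ⊑ dval eta x z.
Proof. by move: Z z; apply/drimpP; apply: qle_refl. Qed.

Lemma dcompP (A B C : qcat) (psi : dist B C) (phi : dist A B) X Z
    (x : A X) (z : C Z) (k : qarr X Z) :
  dval (dcomp psi phi) x z ⊑ k <->
  forall Y (y : B Y), dval psi y z ∘ dval phi x y ⊑ k.
Proof.
split=> [H Y y|H].
  by apply: qle_trans H; apply: qsup_ub; exists Y, y.
by apply: qsup_least => _ [Y [y ->]].
Qed.

(** The object set of *_X: one object, whose type is X. *)
Inductive star_ob X : Q -> Type := star_pt : star_ob X X.

Arguments star_pt {X}.

Definition star_hom X Y Z (s : star_ob X Y) (s' : star_ob X Z) : qarr Y Z :=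
  match s in star_ob _ Y, s' in star_ob _ Z return qarr Y Z with
  | star_pt, star_pt => qid X
  end.

Program Definition star X : qcat := @QCat (star_ob X) (@star_hom X) _ _.
Next Obligation. move=> X Y x; by case: x; apply: qle_refl. Qed.
Next Obligation.
move=> X Y Z W x y z; case: x y z => [] [] []; rewrite qcomp1f.
exact: qle_refl.
Qed.

Lemma dist_ext (A B : qcat) (phi psi : dist A B) :
  (forall X Y (x : A X) (y : B Y), dval phi x y = dval psi x y) -> phi = psi.
Proof.
case: phi => f f1 f2; case: psi => g g1 g2 /= H.
have E : f = g by do 4![apply: functional_extensionality_dep => ?].
by subst g; f_equal; apply: proof_irrelevance.
Qed.

Lemma qfun_ext (A B : qcat) (F G : qfun A B) :
  (forall X (x : A X), F X x = G X x) -> F = G.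
Proof.
case: F => f Hf; case: G => g Hg /= H.
have E : f = g by do 2![apply: functional_extensionality_dep => ?].
by subst g; f_equal; apply: proof_irrelevance.
Qed.

(** The value of the presheaf mu at x, taken at the only object of the star. *)
Definition pval (A : qcat) X (mu : dist A (star X)) Y (x : A Y) : qarr Y X :=
  dval mu x star_pt.

(** PA and P†A; both homs, lambda ↙ mu and lambda ↘ mu, are distributors from
    *_X to *_Y, taken at their only entry. *)
Program Definition psh (A : qcat) : qcat :=
  @QCat (fun X => dist A (star X))
    (fun X Y mu lambda =>
       dval (dlimp lambda mu) (star_pt : star X X) (star_pt : star Y Y)) _ _.
Next Obligation. move=> A X mu; by apply/dlimpP => Y y; rewrite qcomp1f; apply: qle_refl. Qed.
Next Obligation.
move=> A X Y Z x y z.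
apply/dlimpP => W w; rewrite -qcompA.
apply: qle_trans (dlimp_comp z y w star_pt star_pt).
by apply: qcomp_monor; apply: dlimp_comp.
Qed.

Program Definition copsh (A : qcat) : qcat :=
  @QCat (fun X => dist (star X) A)
    (fun X Y mu lambda =>
       dval (drimp lambda mu) (star_pt : star X X) (star_pt : star Y Y)) _ _.
Next Obligation. move=> A X mu; by apply/drimpP => Y y; rewrite qcompf1; apply: qle_refl. Qed.
Next Obligation.
move=> A X Y Z x y z.
apply/drimpP => W w; rewrite qcompA.
apply: qle_trans (drimp_comp y x star_pt star_pt w).
by apply: qcomp_monol; apply: drimp_comp.
Qed.

Lemma pshP (A : qcat) X Y (mu : psh A X) (lambda : psh A Y) k :
  k ⊑ qhom mu lambda <->
  forall Z (x : A Z), k ∘ pval mu x ⊑ pval lambda x.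
Proof. exact: dlimpP. Qed.

Lemma copshP (A : qcat) X Y (mu : copsh A X) (lambda : copsh A Y) k :
  k ⊑ qhom mu lambda <->
  forall Z (x : A Z),
    dval lambda (star_pt : star Y Y) x ∘ k ⊑ dval mu (star_pt : star X X) x.
Proof. exact: drimpP. Qed.

Lemma psh_hom_comp (A : qcat) X Y (mu : psh A X) (lambda : psh A Y) Z (x : A Z) :
  qhom mu lambda ∘ pval mu x ⊑ pval lambda x.
Proof. by move: Z x; apply/pshP; apply: qle_refl. Qed.

Lemma copsh_hom_comp (A : qcat) X Y (mu : copsh A X) (lambda : copsh A Y)
    Z (x : A Z) :
  dval lambda (star_pt : star Y Y) x ∘ qhom mu lambda
  ⊑ dval mu (star_pt : star X X) x.
Proof. by move: Z x; apply/copshP; apply: qle_refl. Qed.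

Lemma pleP (A : qcat) X (mu lambda : psh A X) :
  ule mu lambda <-> forall Y (x : A Y), pval mu x ⊑ pval lambda x.
Proof.
by split=> [/pshP H Y x|H]; [move: (H Y x)|apply/pshP => Y x]; rewrite qcomp1f.
Qed.

Lemma psh_ext (A : qcat) X (mu lambda : psh A X) :
  (forall Y (x : A Y), pval mu x = pval lambda x) -> mu = lambda.
Proof. by move=> H; apply: dist_ext => Y Z x [] ; apply: H. Qed.

Lemma ple_anti (A : qcat) X (mu lambda : psh A X) :
  ule mu lambda -> ule lambda mu -> mu = lambda.
Proof.
move=> /pleP H1 /pleP H2; apply: psh_ext => Y x.
by apply: qle_anti.
Qed.

Lemma ule_trans (A : qcat) X (y x z : A X) : ule x y -> ule y z -> ule x z.
Proof.
move=> H1 H2; apply: qle_trans (qhomM x y z).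
rewrite -[qid X]qcomp1f; apply: (qle_trans (qcomp_monol _ H2)).
exact: qcomp_monor.
Qed.

Lemma ule_refl (A : qcat) X (x : A X) : ule x x.
Proof. exact: qhom1. Qed.

Lemma qfun_ule (A B : qcat) (F : qfun A B) X (x y : A X) :
  ule x y -> ule (F X x) (F X y).
Proof. by move=> H; apply: (qle_trans H); apply: qfun_hom. Qed.

(** phi_↑ : mu |-> phi ↙ mu and phi^↓ : lambda |-> lambda ↘ phi. *)
Program Definition dup (A B : qcat) (phi : dist A B) : qfun (psh A) (copsh B) :=
  @QFun (psh A) (copsh B) (fun X mu => dlimp phi mu) _.
Next Obligation.
move=> A B phi X Y x x'.
apply/copshP => Z z; apply/dlimpP => W w; rewrite -qcompA.
apply: (@qle_trans _ _ _ (dval (dlimp phi x') (star_pt : star Y Y) z ∘ pval x' w)).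
  by apply: qcomp_monor; apply: psh_hom_comp.
by move: W w; apply/dlimpP; apply: qle_refl.
Qed.

Program Definition ddown (A B : qcat) (phi : dist A B) : qfun (copsh B) (psh A) :=
  @QFun (copsh B) (psh A) (fun X lambda => drimp lambda phi) _.
Next Obligation.
move=> A B phi X Y x x'.
apply/pshP => Z z; apply/drimpP => W w; rewrite qcompA.
apply: (@qle_trans _ _ _
  (dval x (star_pt : star X X) w ∘ dval (drimp x phi) z (star_pt : star X X))).
  by apply: qcomp_monol; apply: copsh_hom_comp.
by move: W w; apply/drimpP; apply: qle_refl.
Qed.

Lemma ddownupP (A B : qcat) (phi : dist A B) X (mu : psh A X) Y (x : A Y) k :
  k ⊑ pval (ddown phi X (dup phi X mu)) x <->
  forall Z (y : B Z) (l : qarr X Z),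
    (forall W (w : A W), l ∘ pval mu w ⊑ dval phi w y) ->
    l ∘ k ⊑ dval phi x y.
Proof.
split.
  move=> /drimpP H Z y l Hl; apply: qle_trans (H Z y).
  by apply: qcomp_monol; apply/dlimpP.
move=> H; apply/drimpP => Z y; apply: H.
by apply/dlimpP; apply: qle_refl.
Qed.

(** F_♮ and F^♮. *)
Program Definition graph (A B : qcat) (F : qfun A B) : dist A B :=
  @Dist A B (fun X Y x y => qhom (F X x) y) _ _.
Next Obligation. move=> A B F X Y Y' x y' y; exact: qhomM. Qed.
Next Obligation.
move=> A B F X X' Y x x' y.
by apply: qle_trans (qhomM _ (F _ x') _); apply: qcomp_monor; apply: qfun_hom.
Qed.

Program Definition cograph (A B : qcat) (F : qfun A B) : dist B A :=
  @Dist B A (fun Y X y x => qhom y (F X x)) _ _.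
Next Obligation.
move=> A B F X Y Y' x y' y.
by apply: qle_trans (qhomM _ (F _ y') _); apply: qcomp_monol; apply: qfun_hom.
Qed.
Next Obligation. move=> A B F X X' Y x x' y; exact: qhomM. Qed.

(** F^→ : mu |-> mu ∘ F^♮ and F^← : lambda |-> lambda ∘ F_♮. *)
Program Definition pdir (A B : qcat) (F : qfun A B) : qfun (psh A) (psh B) :=
  @QFun (psh A) (psh B) (fun X mu => dcomp mu (cograph F)) _.
Next Obligation.
move=> A B F X Y x x'.
apply/pshP => Z z; rewrite /pval {2}/dval /= qcomp_supr.
apply: qsup_least => _ [_ [W [w ->]] ->]; rewrite qcompA.
apply: (@qle_trans _ _ _ (dval x' w (star_pt : star Y Y) ∘ dval (cograph F) z w)).
  by apply: qcomp_monol; apply: psh_hom_comp.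
by apply: qsup_ub; exists W, w.
Qed.

Program Definition pinv (A B : qcat) (F : qfun A B) : qfun (psh B) (psh A) :=
  @QFun (psh B) (psh A) (fun X lambda => dcomp lambda (graph F)) _.
Next Obligation.
move=> A B F X Y x x'.
apply/pshP => Z z; rewrite /pval {2}/dval /= qcomp_supr.
apply: qsup_least => _ [_ [W [w ->]] ->]; rewrite qcompA.
apply: (@qle_trans _ _ _ (dval x' w (star_pt : star Y Y) ∘ dval (graph F) z w)).
  by apply: qcomp_monol; apply: psh_hom_comp.
by apply: qsup_ub; exists W, w.
Qed.

Lemma pinvE (A B : qcat) (F : qfun A B) X (lambda : psh B X) Y (x : A Y) :
  pval (pinv F X lambda) x = pval lambda (F Y x).
Proof.
apply: qle_anti.
  by apply/dcompP => Z y; apply: dist_r.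
apply: (@qle_trans _ _ _ (pval lambda (F Y x) ∘ qhom (F Y x) (F Y x))).
  by rewrite -{1}[pval lambda _]qcompf1; apply: qcomp_monor; apply: qhom1.
by apply: qsup_ub; exists Y, (F Y x).
Qed.

Lemma pdir_ule (A B : qcat) (F : qfun A B) X (mu : psh A X) (lambda : psh B X) :
  ule (pdir F X mu) lambda <-> ule mu (pinv F X lambda).
Proof.
split=> [/pleP H|/pleP H]; apply/pleP => Y x.
  rewrite pinvE; apply: qle_trans (H _ _).
  apply: (@qle_trans _ _ _ (pval mu x ∘ qhom (F Y x) (F Y x))).
    by rewrite -{1}[pval mu _]qcompf1; apply: qcomp_monor; apply: qhom1.
  by apply: qsup_ub; exists Y, x.
apply/dcompP => Z z.
apply: (@qle_trans _ _ _ (pval lambda (F Z z) ∘ qhom x (F Z z))); last exact: dist_r.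
by move: (H Z z); rewrite pinvE => Hz; apply: (qcomp_monol _ Hz).
Qed.

Lemma pinv_comp (A B C : qcat) (G : qfun B C) (F : qfun A B) X (lambda : psh C X) :
  pinv (qfun_comp G F) X lambda = pinv F X (pinv G X lambda).
Proof. by apply: psh_ext => Y x; rewrite !pinvE. Qed.

Lemma pinv_id (A : qcat) X (lambda : psh A X) : pinv (qfun_id A) X lambda = lambda.
Proof. by apply: psh_ext => Y x; rewrite pinvE. Qed.

Record info_ob := InfoOb {
  info_dom : qcat;
  info_cod : qcat;
  info_dist :> dist info_dom info_cod }.

Record infomorphism (phi psi : info_ob) := Infomorphism {
  info_fst : qfun (info_dom phi) (info_dom psi);
  info_snd : qfun (info_cod psi) (info_cod phi);
  infoE : forall X Y (x : info_dom phi X) (y' : info_cod psi Y),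
    dval phi x (info_snd Y y') = dval psi (info_fst X x) y' }.

Lemma infomorphism_ext (phi psi : info_ob) (f g : infomorphism phi psi) :
  info_fst f = info_fst g -> info_snd f = info_snd g -> f = g.
Proof.
case: f => f1 f2 Hf; case: g => g1 g2 Hg /= E1 E2; subst g1 g2.
by f_equal; apply: proof_irrelevance.
Qed.

Definition info_id (phi : info_ob) : infomorphism phi phi :=
  @Infomorphism phi phi (qfun_id _) (qfun_id _) (fun _ _ _ _ => eq_refl).

Program Definition info_comp (phi psi chi : info_ob)
    (g : infomorphism psi chi) (f : infomorphism phi psi) :
    infomorphism phi chi :=
  @Infomorphism phi chi (qfun_comp (info_fst g) (info_fst f))
    (qfun_comp (info_snd f) (info_snd g)) _.
Next Obligation. move=> phi psi chi g f X Y x y' /=; by rewrite !infoE. Qed.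

Program Definition Info : category :=
  @Category info_ob infomorphism info_id info_comp _ _ _.
Next Obligation. by move=> *; apply: infomorphism_ext; apply: qfun_ext. Qed.
Next Obligation. by move=> *; apply: infomorphism_ext; apply: qfun_ext. Qed.
Next Obligation. by move=> *; apply: infomorphism_ext; apply: qfun_ext. Qed.

Record closure_space := ClosureSpace {
  cls_cat : qcat;
  cls_op : qfun (psh cls_cat) (psh cls_cat);
  cls_ext : qfun_le (qfun_id _) cls_op;
  cls_idem : qfun_comp cls_op cls_op = cls_op }.

Record continuous (A B : closure_space) := Continuous {
  cont_fun :> qfun (cls_cat A) (cls_cat B);
  cont_le : qfun_le (qfun_comp (pdir cont_fun) (cls_op A))
                    (qfun_comp (cls_op B) (pdir cont_fun)) }.

Lemma continuous_ext (A B : closure_space) (f g : continuous A B) :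
  cont_fun f = cont_fun g -> f = g.
Proof.
case: f => f Hf; case: g => g Hg /= E; subst g.
by f_equal; apply: proof_irrelevance.
Qed.

Lemma cls_idemE (A : closure_space) X (mu : psh (cls_cat A) X) :
  cls_op A X (cls_op A X mu) = cls_op A X mu.
Proof. by have := f_equal (fun F => qfun_map F mu) (cls_idem A). Qed.

Lemma continuousP (A B : closure_space) (F : qfun (cls_cat A) (cls_cat B)) :
  qfun_le (qfun_comp (pdir F) (cls_op A)) (qfun_comp (cls_op B) (pdir F)) <->
  forall X (lambda : psh (cls_cat B) X), cls_op B X lambda = lambda ->
    cls_op A X (pinv F X lambda) = pinv F X lambda.
Proof.
split=> [H X lambda E|H X mu /=].
  apply: ple_anti; last exact: (@cls_ext A X (pinv F X lambda)).
  apply/pdir_ule; apply: (ule_trans (H X (pinv F X lambda))) => /=.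
  rewrite -{2}E; apply: qfun_ule; apply/pdir_ule; exact: ule_refl.
apply/pdir_ule; rewrite -H ?cls_idemE //.
by apply: qfun_ule; apply/pdir_ule; apply: (@cls_ext B X (pdir F X mu)).
Qed.

Program Definition cont_id (A : closure_space) : continuous A A :=
  @Continuous A A (qfun_id _) _.
Next Obligation. move=> A; by apply/continuousP => X lambda E; rewrite pinv_id. Qed.

Program Definition cont_comp (A B C : closure_space)
    (G : continuous B C) (F : continuous A B) : continuous A C :=
  @Continuous A C (qfun_comp G F) _.
Next Obligation.
move=> A B C G F.
apply/continuousP => X lambda E; rewrite pinv_comp.
apply: (proj1 (continuousP F)); first exact: cont_le.
by apply: (proj1 (continuousP G)); first exact: cont_le.
Qed.

Program Definition Cls : category :=
  @Category closure_space continuous cont_id cont_comp _ _ _.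
Next Obligation. by move=> *; apply: continuous_ext; apply: qfun_ext. Qed.
Next Obligation. by move=> *; apply: continuous_ext; apply: qfun_ext. Qed.
Next Obligation. by move=> *; apply: continuous_ext; apply: qfun_ext. Qed.

Definition down_up (phi : info_ob) :
    qfun (psh (info_dom phi)) (psh (info_dom phi)) :=
  qfun_comp (ddown phi) (dup phi).

Lemma down_up_ext (phi : info_ob) : qfun_le (qfun_id _) (down_up phi).
Proof. by move=> X mu; apply/pleP => Y x; apply/ddownupP => Z y l; apply. Qed.

Lemma down_up_idem (phi : info_ob) :
  qfun_comp (down_up phi) (down_up phi) = down_up phi.
Proof.
apply: qfun_ext => X mu; apply: ple_anti; last exact: down_up_ext.
apply/pleP => Y x; apply/ddownupP => Z y l Hl.
move/ddownupP: (qle_refl (pval (down_up phi X (down_up phi X mu)) x)); apply.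
move=> W w; move/ddownupP: (qle_refl (pval (down_up phi X mu) w)); exact.
Qed.

Definition U_ob (phi : info_ob) : closure_space :=
  @ClosureSpace (info_dom phi) (down_up phi) (@down_up_ext phi) (@down_up_idem phi).

Lemma info_fst_cont (phi psi : info_ob) (f : infomorphism phi psi) :
  qfun_le (qfun_comp (pdir (info_fst f)) (cls_op (U_ob phi)))
          (qfun_comp (cls_op (U_ob psi)) (pdir (info_fst f))).
Proof.
move=> X mu; apply/pdir_ule; apply/pleP => Y x; rewrite pinvE.
apply/ddownupP => Z y l Hl; rewrite -infoE.
move/ddownupP: (qle_refl (pval (down_up phi X mu) x)); apply=> W w.
rewrite infoE; apply: qle_trans (Hl W (info_fst f W w)).
apply: qcomp_monor; rewrite -pinvE; move: W w; apply/pleP.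
apply/pdir_ule; exact: ule_refl.
Qed.

Definition U_mor (phi psi : info_ob) (f : infomorphism phi psi) :
    continuous (U_ob phi) (U_ob psi) :=
  @Continuous (U_ob phi) (U_ob psi) (info_fst f) (info_fst_cont f).

Program Definition func_U : functor Info Cls := @Functor Info Cls U_ob U_mor _ _.
Next Obligation. move=> *; exact: continuous_ext. Qed.
Next Obligation. move=> *; exact: continuous_ext. Qed.

(** C(PA), the full subcategory of PA on the fixed points of C. *)
Definition fixed_psh (A : closure_space) : qcat :=
  @QCat (fun X => {mu : psh (cls_cat A) X | cls_op A X mu = mu})
    (fun X Y mu lambda => qhom (proj1_sig mu) (proj1_sig lambda))
    (fun X mu => qhom1 (proj1_sig mu))
    (fun X Y Z mu lambda nu =>
       qhomM (proj1_sig mu) (proj1_sig lambda) (proj1_sig nu)).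

Program Definition zeta (A : closure_space) : dist (cls_cat A) (fixed_psh A) :=
  @Dist (cls_cat A) (fixed_psh A) (fun X Y x mu => pval (proj1_sig mu) x) _ _.
Next Obligation. move=> A X Y Y' x y' y; exact: psh_hom_comp. Qed.
Next Obligation. move=> A X X' Y x x' y; exact: dist_r. Qed.

Lemma pinv_fixed (A B : closure_space) (F : continuous A B) X
    (lambda : psh (cls_cat B) X) :
  cls_op B X lambda = lambda -> cls_op A X (pinv F X lambda) = pinv F X lambda.
Proof. by apply: (proj1 (continuousP F)); exact: cont_le. Qed.

(** F^◁, the restriction of F^← to fixed points. *)
Definition pinv_restr (A B : closure_space) (F : continuous A B) :
    qfun (fixed_psh B) (fixed_psh A) :=
  @QFun (fixed_psh B) (fixed_psh A)
    (fun X lambda => exist _ (pinv F X (proj1_sig lambda))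
                           (pinv_fixed F (proj2_sig lambda)))
    (fun X Y lambda lambda' =>
       qfun_hom (pinv F) (proj1_sig lambda) (proj1_sig lambda')).

Lemma fixed_psh_ext (A : closure_space) X (mu lambda : fixed_psh A X) :
  proj1_sig mu = proj1_sig lambda -> mu = lambda.
Proof.
case: mu => mu Hmu; case: lambda => lambda Hl /= E; subst lambda.
by f_equal; apply: proof_irrelevance.
Qed.

Definition F_ob (A : closure_space) : info_ob := InfoOb (zeta A).

Program Definition F_mor (A B : closure_space) (F : continuous A B) :
    infomorphism (F_ob A) (F_ob B) :=
  @Infomorphism (F_ob A) (F_ob B) F (pinv_restr F) _.
Next Obligation. move=> A B F X Y x y'; exact: pinvE. Qed.

Program Definition func_F : functor Cls Info := @Functor Cls Info F_ob F_mor _ _.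
Next Obligation.
move=> A.
apply: infomorphism_ext => //; apply: qfun_ext => X mu.
by apply: fixed_psh_ext; apply: pinv_id.
Qed.
Next Obligation.
move=> A B C G F.
apply: infomorphism_ext => //; apply: qfun_ext => X mu.
by apply: fixed_psh_ext; apply: pinv_comp.
Qed.

End Quantaloid.

(* Main.v *)
(** The identity [phi^↓ ∘ phi_↑ = C] for [phi = zeta C] holds because a fixed
    point [lambda] of [C] satisfies [PA(mu, lambda) ≤ PA(C mu, lambda)], by
    functoriality of [C], and [C mu] is itself a fixed point.  Hence the unit of
    the adjunction is the identity.  The counit at [phi : A ⇝ B] is the identity
    of [A] together with [y |-> phi(-, y)], which lands in the fixed points of
    [phi^↓ ∘ phi_↑]; an infomorphism [(F, G)] out of [zeta C] is determined by
    [F], since [(G y)(x) = phi(F x, y)]. *)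
From Corelib Require Import ssreflect ssrfun ssrbool.
From Stdlib Require Import FunctionalExtensionality ProofIrrelevance.
Require Import Defs.

Set Implicit Arguments.
Unset Strict Implicit.
Unset Printing Implicit Defensive.

#[local] Obligation Tactic := idtac.
Local Open Scope quant_scope.

(** An equality of objects turned into a morphism, so that functors whose object maps are only
    propositionally equal can be compared by a commuting square. *)
Definition eq_mor (C : category) (a b : C) (e : a = b) : mor a b :=
  match e in _ = b return mor a b with eq_refl => idm a end.

Lemma functor_ext (C D : category) (F G : functor C D)
    (e : forall a, F a = G a) :
  (forall a b (f : mor a b),
     compm (eq_mor (e b)) (fmor F f) = compm (fmor G f) (eq_mor (e a))) ->
  F = G.
Proof.
case: F e => F0 F1 F1id F1M; case: G => G0 G1 G1id G1M /= e H.
have E : F0 = G0 by apply: functional_extensionality.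
subst G0.
have {}H : F1 = G1.
  apply: functional_extensionality_dep => a.
  apply: functional_extensionality_dep => b.
  apply: functional_extensionality_dep => f.
  by move: (H a b f); rewrite !(proof_irrelevance _ (e _) eq_refl) /= comp1m compm1.
by subst G1; f_equal; apply: proof_irrelevance.
Qed.

Section Adjunction.
Variable Q : quantaloid.

Lemma down_up_zeta (A : closure_space Q) : down_up (F_ob A) = cls_op A.
Proof.
apply: qfun_ext => X mu; apply: psh_ext => Y x; apply: qle_anti.
  have /ddownupP H := qle_refl (pval (down_up (F_ob A) X mu) x).
  (* Test against the fixed point [cls_op A X mu], with the identity as [l]. *)
  rewrite -[pval _ x]qcomp1f.
  apply: (H X (exist _ (cls_op A X mu) (cls_idemE mu))) => W w.
  by rewrite qcomp1f; move: W w; apply/pleP; apply: (@cls_ext Q A X mu).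
apply/ddownupP => Z [lambda E] l Hl /=.
have {}Hl : l ⊑ qhom mu lambda by apply/pshP.
have := qle_trans Hl (qfun_hom (cls_op A) mu lambda).
by rewrite E => /pshP; apply.
Qed.

Lemma closure_space_ext (A : qcat Q) (C C' : qfun (psh A) (psh A)) p p' q q' :
  C = C' -> @ClosureSpace Q A C p q = @ClosureSpace Q A C' p' q'.
Proof. by move=> E; subst C'; f_equal; apply: proof_irrelevance. Qed.

(** Having [C = C'] separately allows substitution without inverting [e]; then [e] is a loop, equal
    to [eq_refl] by proof irrelevance. *)
Lemma cont_fun_eq_mor (A : qcat Q) (C C' : qfun (psh A) (psh A)) p p' q q'
    (e : @ClosureSpace Q A C p q = @ClosureSpace Q A C' p' q') :
  C = C' -> cont_fun (@eq_mor (Cls Q) _ _ e) = qfun_id A.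
Proof.
move=> E; subst C'.
move: e; rewrite (proof_irrelevance _ p' p) (proof_irrelevance _ q' q) => e.
by rewrite (proof_irrelevance _ e eq_refl).
Qed.

Lemma U_F_ob (A : closure_space Q) : U_ob (F_ob A) = A.
Proof. by case: A (down_up_zeta A) => A C p q; apply: closure_space_ext. Qed.

Lemma cont_fun_U_F_ob (A : closure_space Q) :
  cont_fun (@eq_mor (Cls Q) _ _ (U_F_ob A)) = qfun_id (cls_cat A).
Proof.
by case: A (U_F_ob A) (down_up_zeta A) => A C p q; apply: cont_fun_eq_mor.
Qed.

Lemma func_U_F : functor_comp (func_U Q) (func_F Q) = functor_id (Cls Q).
Proof.
refine (@functor_ext (Cls Q) (Cls Q) (functor_comp (func_U Q) (func_F Q)) (functor_id (Cls Q)) U_F_ob _) => A B F.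
refine (@continuous_ext Q (U_ob (F_ob A)) B _ _ _); apply: qfun_ext => X x.
change (cont_fun (@eq_mor (Cls Q) _ _ (U_F_ob B)) X (F X x) =
        F X (cont_fun (@eq_mor (Cls Q) _ _ (U_F_ob A)) X x)).
by rewrite !cont_fun_U_F_ob.
Qed.

(** The presheaf phi(-, y); matching on [s] identifies [Z] with [Y]. *)
Program Definition dist_at (A B : qcat Q) (phi : dist A B) Y (y : B Y) :
    psh A Y :=
  @Dist Q A (star Y) (fun X Z x s =>
    match s in star_ob _ Z return qarr X Z with star_pt _ => phi X Y x y end) _ _.
Next Obligation.
move=> A B phi Y y X Z Z' x s' s; case: s; case: s'.
by rewrite qcomp1f; apply: qle_refl.
Qed.
Next Obligation.
move=> A B phi Y y X X' Z x x' s; case: s; exact: dist_r.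
Qed.

Lemma down_up_dist_at (phi : info_ob Q) Y (y : info_cod phi Y) :
  down_up phi Y (dist_at phi y) = dist_at phi y.
Proof.
apply: ple_anti; last exact: down_up_ext.
apply/pleP => X x; have /ddownupP H := qle_refl (pval (down_up phi Y (dist_at phi y)) x).
(* Test at [y] itself, with the identity as [l]. *)
rewrite -[X in X ⊑ _]qcomp1f; apply: H => W w.
by rewrite qcomp1f; apply: qle_refl.
Qed.

Program Definition cod_fixed (phi : info_ob Q) :
    qfun (info_cod phi) (fixed_psh (U_ob phi)) :=
  @QFun Q (info_cod phi) (fixed_psh (U_ob phi))
    (fun Y y => exist _ (dist_at phi y) (down_up_dist_at y)) _.
Next Obligation. move=> phi X Y y y'; apply/pshP => Z x; exact: dist_l. Qed.

Definition counit (phi : info_ob Q) : infomorphism (F_ob (U_ob phi)) phi :=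
  @Infomorphism Q (F_ob (U_ob phi)) phi (qfun_id _) (cod_fixed phi)
    (fun _ _ _ _ => eq_refl).

Lemma adjunct_cont (A : closure_space Q) (phi : info_ob Q)
    (f : infomorphism (F_ob A) phi) :
  qfun_le (qfun_comp (pdir (info_fst f)) (cls_op A))
          (qfun_comp (cls_op (U_ob phi)) (pdir (info_fst f))).
Proof. rewrite -(down_up_zeta A); exact: (info_fst_cont f). Qed.

(** The action of U on [f], with source [A] in place of [U_ob (F_ob A)]; this avoids composing with
    [eq_mor]. *)
Definition adjunct (A : closure_space Q) (phi : info_ob Q)
    (f : infomorphism (F_ob A) phi) : continuous A (U_ob phi) :=
  @Continuous Q A (U_ob phi) (info_fst f) (adjunct_cont f).

Lemma adjunct_bij (A : closure_space Q) (phi : info_ob Q) :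
  bijective (@adjunct A phi).
Proof.
(* The inverse is the transpose along the counit. *)
exists (fun F => info_comp (counit phi) (F_mor F)) => [f|F]; last first.
  by apply: continuous_ext; apply: qfun_ext.
apply: infomorphism_ext; first exact: qfun_ext.
apply: qfun_ext => Y y; apply: fixed_psh_ext; apply: psh_ext => X x.
(* The infomorphism equation for [f] forces its second component. *)
apply: etrans (esym (infoE f x y)).
exact: (pinvE (info_fst f) (dist_at phi y) x).
Qed.

Lemma func_F_left_adjoint : left_adjoint (func_F Q) (func_U Q).
Proof.
exists adjunct; split=> [A phi|A A' phi phi' u v f]; first exact: adjunct_bij.
(* Both sides have the composite of the first components of [v] and [f] with [u] as underlying
   functor. *)
by apply: continuous_ext; apply: qfun_ext.
Qed.

End Adjunction.

Theorem theorem5p2p2 (Q : quantaloid) :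
  left_adjoint (func_F Q) (func_U Q) /\ functor_comp (func_U Q) (func_F Q) = functor_id (Cls Q).
Proof. by split; [exact: func_F_left_adjoint | exact: func_U_F]. Qed.
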